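(* Let $f\in\mathcal{S}_L$ with $\arg\min f\neq\varnothing$, and fix $x^\star\in\arg\min f$. Let $x_0,y_0\in\mathbb{R}^d$, let $P_0\in\mathbb{R}^{d\times d}$ be diagonal with $P_0\succ0$, and set $P_{-1}:=P_0$. Generate $(x_k,y_k,P_k)$ by $$\frac{x_{k+1}-x_k}{\alpha_k}=y_k-x_{k+1}-\beta_kP_{k-1}^{-1}\nabla f(x_k),\qquad \frac{y_{k+1}-y_k}{\alpha_k}=-P_k^{-1}\nabla f(x_{k+1}),$$ $$\frac{P_{k+1}-P_k}{\alpha_k}=-P_{k+1}+\gamma_kP_k^{-1}G_{k+1}^2,\qquad G_{k+1}^2=\mathrm{diag}\big((\partial_1 f(x_{k+1}))^2,\dots,(\partial_d f(x_{k+1}))^2\big),$$ the method being terminated at the first index $\ell$ with $\nabla f(x_\ell)=0$, if there is one. Put $\eta_k:=\alpha_k\beta_k$ and $x_k^+:=x_k-\eta_kP_{k-1}^{-1}\nabla f(x_k)$ (so $x_\ell^+=x_\ell$ at a terminal index $\ell$). Assume there exists $R>0$ with $\sup_{k\ge0}\|y_k-x^\star\|_\infty\le R$. Suppose that for each $k$ with $\nabla f(x_k)\neq0$ the exact adaptive step is used: $$\eta_k=\bar\eta(P_{k-1}^{-1},\nabla f(x_k)),\qquad \alpha_k=\sqrt{\frac{\eta_k}{2}},\qquad \gamma_k=\frac{\alpha_k}{R^2},$$ and that for all $k\ge0$ (for which $\eta_{k+1}$ is defined, i.e. $x_{k+1}$ is generated and $\nabla f(x_{k+1})\neq0$) $$2\alpha_k^2\le\eta_{k+1}(1+\alpha_k).$$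 Then $$\rho_k:=\prod_{j=0}^k(1+\alpha_j)^{-1}=\mathcal{O}(k^{-2}),$$ and hence $$\mathcal{E}_{k+1}=\mathcal{O}(k^{-2}),\qquad\text{where}\quad \mathcal{E}_k:=f(x_k^+)-f(x^\star)+\tfrac12\|y_k-x^\star\|_{P_k}^2 .$$
   Context: $\mathcal{S}_L$ ($L>0$) is the set of differentiable convex functions $f:\mathbb{R}^d\to\mathbb{R}$ whose gradient is $L$-Lipschitz in the Euclidean norm. For a symmetric matrix $A$, $\|x\|_A^2:=\langle Ax,x\rangle$; $A\succ0$ means symmetric positive definite. $\|\cdot\|_\infty$ is the maximum norm. For $P\succ0$ and $g\ne0$, $$\bar\eta(P^{-1},g):=\frac1L\,\frac{\|g\|_{P^{-1}}^2}{\|g\|_{P^{-2}}^2}.$$ The parameters satisfy $\alpha_k,\beta_k,\gamma_k>0$; since $\eta_k=\alpha_k\beta_k$, the choice of $\eta_k$ and $\alpha_k$ determines $\beta_k=\eta_k/\alpha_k$. All matrices $P_k$ are diagonal and positive definite. If $\nabla f(x_\ell)=0$, then $x_\ell$ is a minimizer and the method stops there. The notation $a_k=\mathcal{O}(k^{-2})$ means that there is a constant $C$, independent of $k$, with $a_k\le Ck^{-2}$ for all $k\ge1$ for which $a_k$ is defined (all $k\ge1$ if the method never terminates). *)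

(* Defs.v *)
From HB Require Import structures.
From mathcomp Require Import all_boot all_order all_algebra.
From mathcomp Require Import all_classical all_reals all_analysis.
Import Order.TTheory GRing.Theory Num.Theory.
Import numFieldNormedType.Exports.

Set Implicit Arguments.
Unset Strict Implicit.
Unset Printing Implicit Defensive.

Local Open Scope classical_set_scope.
Local Open Scope ring_scope.

Section Defs.
Variables (R : realType) (d : nat).
Implicit Types (u v g : 'cV[R]_d) (A : 'M[R]_d) (f : 'cV[R]_d -> R).

Definition dotv u v : R := \sum_i u i 0 * v i 0.

(* The library norm `|u| on 'cV[R]_d is the maximum norm, so the Euclidean
   norm has its own definition. *)
Definition enorm u : R := Num.sqrt (dotv u u).

(* ||u||_A^2 = <A u, u> *)
Definition sqnorm_mx A u : R := dotv (A *m u) u.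

Definition posdefmx A : Prop :=
  A^T = A /\ forall u, u != 0 -> 0 < sqnorm_mx A u.

Definition grad f u : 'cV[R]_d := \col_i 'D_(delta_mx i 0) f u.

Definition smooth_convex (L : R) f : Prop :=
  [/\ forall u, differentiable f u,
      convex_function [set: 'cV[R]_d] f &
      forall u v, enorm (grad f u - grad f v) <= L * enorm (u - v)].

(* The argument A stands for P^-1, so that A *m A is P^-2. *)
Definition eta_bar (L : R) A g : R :=
  L^-1 * (sqnorm_mx A g / sqnorm_mx (A *m A) g).

(* diag ((d_1 f u)^2, ..., (d_d f u)^2) *)
Definition grad_sqmx f u : 'M[R]_d := diag_mx (\row_i (grad f u i 0) ^+ 2).

(* The method stops at the first l with grad f (x l) = 0: the iterate of index
   k exists iff no gradient vanishes before k. Hence the step from k to k.+1 is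
   performed iff [generated f x k.+1]. Total sequences represent the iterates;
   their values beyond the terminal index are irrelevant. *)
Definition generated f (x : nat -> 'cV[R]_d) (k : nat) : Prop :=
  forall j, (j < k)%N -> grad f (x j) != 0.

(* P_{k-1}, with P_{-1} = P_0 because 0.-1 = 0 *)
Definition prevP (P : nat -> 'M[R]_d) (k : nat) : 'M[R]_d := P k.-1.

Definition step_size (alpha beta : nat -> R) (k : nat) : R := alpha k * beta k.

(* At a terminal index the gradient is 0, so this is x k whatever the
   (meaningless) values of alpha k and beta k are. *)
Definition xplus f (alpha beta : nat -> R) (P : nat -> 'M[R]_d)
    (x : nat -> 'cV[R]_d) (k : nat) : 'cV[R]_d :=
  x k - step_size alpha beta k *: (invmx (prevP P k) *m grad f (x k)).

Definition rho (alpha : nat -> R) (k : nat) : R :=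
  \prod_(0 <= j < k.+1) (1 + alpha j)^-1.

Definition energy f (xstar : 'cV[R]_d) (alpha beta : nat -> R)
    (P : nat -> 'M[R]_d) (x y : nat -> 'cV[R]_d) (k : nat) : R :=
  f (xplus f alpha beta P x k) - f xstar
  + 2^-1 * sqnorm_mx (P k) (y k - xstar).

End Defs.

(* Main.v *)
Require Import Defs.
From HB Require Import structures.
From mathcomp Require Import all_boot all_order all_algebra.
From mathcomp Require Import ring lra.
From mathcomp Require Import all_classical all_reals all_analysis.
Import Order.TTheory GRing.Theory Num.Theory.
Import numFieldNormedType.Exports.
Local Open Scope classical_set_scope.
Local Open Scope ring_scope.

(** The proof is a Lyapunov argument: the energy contracts,
      (1 + alpha_k) * E_{k+1} <= E_k,
    so E_{k+1} <= rho_k * E_0, and rho_k itself decays like k^-2.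

    For the contraction (energy_contract), write g = grad f x_{k+1}. The x-step
    reads (1 + alpha_k) x_{k+1} = x_k^+ + alpha_k y_k, so the tangent
    inequalities of the convex function f at x_{k+1} towards x_k^+ and xstar add
    up to
      (1 + alpha_k) (f x_{k+1} - f xstar)
        <= f x_k^+ - f xstar + alpha_k <g, y_k - xstar>.
    Expanding the y-step in the norm of P_k produces the opposite inner product
    and a remainder alpha_k^2 / 2 * |g|^2 in the norm of P_k^-1. Passing from P_k
    to P_{k+1} costs at most the same remainder again, since every coordinate of
    y_{k+1} - xstar is at most Rad and gamma_k = alpha_k / Rad^2. The total
    remainder alpha_k^2 |g|^2 is paid for by the gradient step from x_{k+1} to
    x_{k+1}^+: with the exact adaptive step, L-smoothness decreases f by
    eta_{k+1} / 2 * |g|^2 (eta_bar_descent), and step_cond says that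
    alpha_k^2 <= (1 + alpha_k) * eta_{k+1} / 2. If g = 0 there is nothing to pay.

    For the rate, eta_k = 2 alpha_k^2 turns step_cond into
    alpha_k^2 / (1 + alpha_k) <= alpha_{k+1}^2, which telescopes to
    alpha_0^2 rho_k <= alpha_{k+1}^2 (alpha_sqr_ge). Thus S_k = 1 / rho_k
    satisfies S_{k+1} = S_k + alpha_{k+1} S_k >= S_k + alpha_0 sqrt S_k and grows
    quadratically (rho_sqr_le). *)

Set Implicit Arguments.
Unset Strict Implicit.

(** * Euclidean geometry and diagonal matrices *)

Section EuclideanSpace.
Variables (R : realType) (d : nat).
Implicit Types (u v w g : 'cV[R]_d) (A : 'M[R]_d) (p : 'rV[R]_d).

Lemma dotvC u v : dotv u v = dotv v u.
Proof. by apply: eq_bigr => i _; rewrite mulrC. Qed.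

Lemma dotvDl u v w : dotv (u + v) w = dotv u w + dotv v w.
Proof. by rewrite -big_split; apply: eq_bigr => i _; rewrite mxE mulrDl. Qed.

Lemma dotvZl a u v : dotv (a *: u) v = a * dotv u v.
Proof. by rewrite mulr_sumr; apply: eq_bigr => i _; rewrite mxE mulrA. Qed.

Lemma dotvBl u v w : dotv (u - v) w = dotv u w - dotv v w.
Proof. by rewrite -scaleN1r dotvDl dotvZl mulN1r. Qed.

Lemma dotvDr u v w : dotv u (v + w) = dotv u v + dotv u w.
Proof. by rewrite !(dotvC u) dotvDl. Qed.

Lemma dotvBr u v w : dotv u (v - w) = dotv u v - dotv u w.
Proof. by rewrite !(dotvC u) dotvBl. Qed.

Lemma dotvZr a u v : dotv u (a *: v) = a * dotv u v.
Proof. by rewrite !(dotvC u) dotvZl. Qed.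

Lemma dotv_ge0 u : 0 <= dotv u u.
Proof. by apply: sumr_ge0 => i _; rewrite -expr2 sqr_ge0. Qed.

Lemma dotv0_eq0 u : dotv u u = 0 -> u = 0.
Proof.
move=> /eqP; rewrite psumr_eq0; last by move=> i _; rewrite -expr2 sqr_ge0.
move=> /allP u0; apply/colP => i; rewrite mxE.
by have /u0 /= := mem_index_enum i; rewrite mulf_eq0 orbb => /eqP.
Qed.

Lemma enorm_ge0 u : 0 <= enorm u.
Proof. exact: sqrtr_ge0. Qed.

Lemma sqr_enorm u : enorm u ^+ 2 = dotv u u.
Proof. by rewrite sqr_sqrtr ?dotv_ge0. Qed.

Lemma enormZ a u : enorm (a *: u) = `|a| * enorm u.
Proof.
by rewrite /enorm dotvZl dotvZr mulrA -expr2 sqrtrM ?sqr_ge0 // sqrtr_sqr.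
Qed.

(** The Cauchy-Schwarz inequality. *)
Lemma dotv_le_enorm u v : dotv u v <= enorm u * enorm v.
Proof.
have [u0|u0] := eqVneq (enorm u) 0.
  have -> : u = 0 by apply: dotv0_eq0; rewrite -sqr_enorm u0 expr0n.
  by rewrite -[0 in leLHS](scale0r 0) dotvZl mul0r mulr_ge0 ?enorm_ge0.
have [v0|v0] := eqVneq (enorm v) 0.
  have -> : v = 0 by apply: dotv0_eq0; rewrite -sqr_enorm v0 expr0n.
  by rewrite -[0 in leLHS](scale0r 0) dotvZr mul0r mulr_ge0 ?enorm_ge0.
have nu : 0 < enorm u by rewrite lt0r u0 enorm_ge0.
have nv : 0 < enorm v by rewrite lt0r v0 enorm_ge0.
have := dotv_ge0 (enorm v *: u - enorm u *: v).
rewrite dotvBl !dotvBr !dotvZl !dotvZr -!sqr_enorm (dotvC v u) => H.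
have {}H : 0 <= (enorm u * enorm v) * (enorm u * enorm v - dotv u v) by nra.
by rewrite pmulr_rge0 ?mulr_gt0 // subr_ge0 in H.
Qed.

Lemma sqnorm_mx_sym A u :
  A^T = A -> sqnorm_mx (A *m A) u = dotv (A *m u) (A *m u).
Proof.
move=> sA; have dotE (v w : 'cV[R]_d) : dotv v w = (v^T *m w) 0 0.
  by rewrite mxE; apply: eq_bigr => i _; rewrite mxE.
by rewrite /sqnorm_mx !dotE !trmx_mul sA !mulmxA.
Qed.

Lemma sqnorm_diag p u : sqnorm_mx (diag_mx p) u = \sum_i p 0 i * u i 0 ^+ 2.
Proof.
by apply: eq_bigr => i _; rewrite mul_diag_mx mxE expr2 mulrA.
Qed.

Lemma invmx_diag p :
  (forall i, 0 < p 0 i) -> invmx (diag_mx p) = diag_mx (\row_i (p 0 i)^-1).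
Proof.
move=> p0; set q := \row_i _.
have qp : diag_mx q *m diag_mx p = 1%:M.
  rewrite mulmx_diag -diag_const_mx; congr diag_mx; apply/rowP => i.
  by rewrite !mxE mulVf // gt_eqF.
have [_ up] := mulmx1_unit qp.
by rewrite -[RHS]mulmx1 -(mulmxV up) mulmxA qp mul1mx.
Qed.

Lemma ler_coord_norm (u : 'cV[R]_d) i : `|u i 0| <= `|u|.
Proof.
rewrite [leRHS]/Num.Def.normr /= mx_normrE.
exact: (le_bigmax_cond _ (fun ij : 'I_d * 'I_1 => `|u ij.1 ij.2|) (j := (i, 0))).
Qed.

End EuclideanSpace.

(** * Smooth convex functions and one step of the method *)

(** Solving the implicit update of the x-step and of the P-step for its new
    value. *)
Lemma implicit_step (R : fieldType) (V : lmodType R) (a : R) (u u' w : V) :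
  a != 0 -> a^-1 *: (u' - u) = - u' + w -> (1 + a) *: u' = u + a *: w.
Proof.
move=> a0 /(congr1 ( *:%R a)); rewrite scalerA mulfV // scale1r => E.
have -> : a *: w = u' - u + a *: u'.
  by rewrite E scalerDr scalerN addrAC addNr add0r.
by rewrite addrA [u + _]addrC subrK scalerDl scale1r.
Qed.

Section SmoothConvex.
Variables (R : realType) (d : nat) (f : 'cV[R]_d -> R).
Implicit Types (u v w : 'cV[R]_d).

Hypothesis df : forall u, differentiable f u.

Lemma derive_grad u w : 'D_w f u = dotv (grad f u) w.
Proof.
rewrite deriveE // {1}(matrix_sum_delta w) linear_sum; apply: eq_bigr => i _.
by rewrite big_ord1 linearZ /= mxE deriveE // mulrC.
Qed.

Lemma is_derive_line u w (t : R) :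
  is_derive t (1 : R) (fun s : R => f (u + s *: w)) (dotv (grad f (u + t *: w)) w).
Proof.
have E : (fun h : R => h^-1 *: (((fun s => f (u + s *: w)) \o shift t) (h *: 1)
            - f (u + t *: w)))
       = (fun h => h^-1 *: ((f \o shift (u + t *: w)) (h *: w) - f (u + t *: w))).
  by apply/funext => h /=; rewrite scaler1 scalerDl addrCA.
split.
- by rewrite /derivable E; apply: diff_derivable.
- by rewrite /derive E -derive_grad.
Qed.

Lemma convex_ge_tangent u v :
  convex_function [set: 'cV[R]_d] f -> f u + dotv (grad f u) (v - u) <= f v.
Proof.
move=> cf; rewrite -lerBrDl -derive_grad.
have dfu : derivable f u (v - u) by exact: diff_derivable.
rewrite /derive cvg_at_rightE //.
apply: limr_le.
  by apply/cvg_ex; eexists; apply: cvg_dnbhs_at_right; exact: dfu.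
near=> h.
have h0 : 0 < h by near: h; exact: nbhs_right_gt.
have h1 : h <= 1 by near: h; exact: nbhs_right_le.
have conv_h : f (h *: v + (1 - h) *: u) <= h * f v + (1 - h) * f u.
  exact: (cf (Itv01 (ltW h0) h1) v u (mem_setT _) (mem_setT _)).
have E : h *: (v - u) + u = h *: v + (1 - h) *: u.
  by rewrite scalerBr scalerBl scale1r -addrA [- _ + u]addrC.
rewrite /= E -[_ *: _]/(_ * _) mulrC ler_pdivrMr //.
lra.
Unshelve. all: by end_near. Qed.

(** The descent lemma. The difference of the two sides along the segment from u
    to u + w, phi below, is nonincreasing: by the Lipschitz bound and
    Cauchy-Schwarz its derivative is nonpositive on [0, 1]. *)
Lemma smooth_descent L u w :
  (forall u v, enorm (grad f u - grad f v) <= L * enorm (u - v)) ->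
  f (u + w) <= f u + dotv (grad f u) w + L / 2 * dotv w w.
Proof.
move=> lip; set c := dotv (grad f u) w; set s := dotv w w.
pose phi (t : R) := f (u + t *: w) - (t * c + t ^+ 2 * (L / 2 * s)).
have dphi (t : R) : is_derive t (1 : R) phi
    (dotv (grad f (u + t *: w)) w - (c + t * (L * s))).
  have line := is_derive_line u w t.
  have poly : is_derive t (1 : R) (fun t => t * c + t ^+ 2 * (L / 2 * s))
      (c + t * (L * s)).
    apply: is_derive_eq.
    by rewrite /GRing.scale /=; field.
  exact: is_deriveB.
have dphi_le0 (t : R) : 0 <= t -> derive1 phi t <= 0.
  move=> t0.
  have slope_le : dotv (grad f (u + t *: w) - grad f u) w <= t * (L * s).
    apply: le_trans (dotv_le_enorm _ _) _.
    apply: le_trans (ler_wpM2r (enorm_ge0 _) (lip _ _)) _.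
    by rewrite addrAC subrr add0r enormZ ger0_norm // /s -sqr_enorm expr2; lra.
  rewrite derive1E (@derive_val _ _ _ _ _ _ _ (dphi t)).
  by rewrite opprD addrA -dotvBl subr_le0; exact: slope_le.
have : phi 1 <= phi 0.
  apply: (@ler0_derive1_le_cc _ phi 0 1) => //; rewrite ?in_itv /= ?lexx ?ler01 //.
  - by move=> t; rewrite in_itv /= => /andP[t0 _]; exact: dphi_le0 (ltW t0).
  - apply: derivable_within_continuous => t _.
    exact: (@ex_derive _ _ _ _ _ _ _ (dphi t)).
rewrite /phi scale1r scale0r addr0; lra.
Qed.

(** The step eta_bar minimizes the quadratic upper bound of the descent lemma in
    the direction A *m g. No assumption g != 0 is needed: when the denominator of
    eta_bar vanishes, eta_bar is 0 and both sides equal f u. *)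
Lemma eta_bar_descent L A u :
  0 < L -> (forall u v, enorm (grad f u - grad f v) <= L * enorm (u - v)) ->
  A^T = A ->
  let g := grad f u in
  f (u - eta_bar L A g *: (A *m g)) <= f u - eta_bar L A g / 2 * sqnorm_mx A g.
Proof.
move=> L0 lip symA /=; set g := grad f u; set eta := eta_bar L A g.
rewrite -scaleNr; apply: le_trans (smooth_descent _ _ lip) _.
rewrite dotvZr dotvZl dotvZr -sqnorm_mx_sym // (dotvC (grad f u)).
rewrite -/g -/(sqnorm_mx A g).
have eta2 : eta * (eta * sqnorm_mx (A *m A) g) * L = eta * sqnorm_mx A g.
  rewrite {1 2 3}/eta /eta_bar.
  have [->|s2] := eqVneq (sqnorm_mx (A *m A) g) 0.
    by rewrite invr0 !(mulr0, mul0r).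
  by field; rewrite s2 gt_eqF.
lra.
Qed.

(** One step of the method contracts the energy. The diagonals of the old and the
    new preconditioner are p and q, and xp, xp' are the old and the new gradient
    step points; xp' enters only through its decrease with respect to x'. *)
Lemma energy_contract (p q : 'rV[R]_d) (xp x' xp' y y' xs : 'cV[R]_d) (a r : R) :
  let g := grad f x' in
  let Pinv := diag_mx (\row_i (p 0 i)^-1) in
  convex_function [set: 'cV[R]_d] f ->
  (forall i, 0 < p 0 i) -> 0 <= a -> 0 < r ->
  (1 + a) *: x' = xp + a *: y ->
  y' = y - a *: (Pinv *m g) ->
  (forall i, (1 + a) * q 0 i = p 0 i + a * (a / r ^+ 2) * (g i 0 ^+ 2 / p 0 i)) ->
  `|y' - xs| <= r ->
  f xp' <= f x' - a ^+ 2 / (1 + a) * sqnorm_mx Pinv g ->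
  (1 + a) * (f xp' - f xs + 2^-1 * sqnorm_mx (diag_mx q) (y' - xs))
    <= f xp - f xs + 2^-1 * sqnorm_mx (diag_mx p) (y - xs).
Proof.
move=> /=; set g := grad f x'; set Pinv := diag_mx _.
move=> cf p0 a0 r0 Ex' Ey' Eq y'r fxp'.
have a1 : 0 < 1 + a by lra.
have tangent_xp := convex_ge_tangent x' xp cf.
have tangent_xs := convex_ge_tangent x' xs cf.
rewrite -/g in tangent_xp tangent_xs.
clearbody g.
(* Coordinatewise, the remainder a^2 / 2 * g_i^2 / p_i arises twice: from
   expanding the y-step (E2) and, times (v / r)^2 <= 1, from the update of the
   preconditioner (E1). *)
have dual : (1 + a) * (2^-1 * sqnorm_mx (diag_mx q) (y' - xs))
    <= 2^-1 * sqnorm_mx (diag_mx p) (y - xs) - a * dotv g (y - xs)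
       + a ^+ 2 * sqnorm_mx Pinv g.
  rewrite !sqnorm_diag /dotv !mulr_sumr -sumrN -!big_split /=.
  apply: ler_sum => i _; rewrite !mxE.
  have pi := p0 i.
  have Ey'i : y' i 0 = y i 0 - a * (g i 0 / p 0 i).
    by rewrite Ey' /Pinv mul_diag_mx !mxE [_^-1 * _]mulrC.
  have := le_trans (ler_coord_norm (y' - xs) i) y'r; rewrite !mxE => yir.
  set v := y' i 0 - xs i 0 in yir *.
  have v2 : v ^+ 2 / r ^+ 2 <= 1.
    rewrite ler_pdivrMr ?exprn_gt0 // mul1r -real_normK ?num_real //.
    by rewrite lerXn2r ?nnegrE // ltW.
  have E1 : (1 + a) * (2^-1 * (q 0 i * v ^+ 2)) =
      2^-1 * (p 0 i * v ^+ 2)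
      + 2^-1 * a ^+ 2 * (g i 0 ^+ 2 / p 0 i) * (v ^+ 2 / r ^+ 2).
    have -> : (1 + a) * (2^-1 * (q 0 i * v ^+ 2))
        = 2^-1 * ((1 + a) * q 0 i) * v ^+ 2 by ring.
    by rewrite Eq; field; rewrite !gt_eqF.
  have E2 : 2^-1 * (p 0 i * v ^+ 2) =
      2^-1 * (p 0 i * (y i 0 - xs i 0) ^+ 2) - a * (g i 0 * (y i 0 - xs i 0))
      + 2^-1 * a ^+ 2 * (g i 0 ^+ 2 / p 0 i).
    by rewrite /v Ey'i; field; rewrite gt_eqF.
  have c0 : 0 <= 2^-1 * a ^+ 2 * (g i 0 ^+ 2 / p 0 i).
    apply: mulr_ge0; first by rewrite mulr_ge0 ?sqr_ge0 // invr_ge0.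
    by rewrite divr_ge0 ?sqr_ge0 // ltW.
  have := ler_wpM2l c0 v2.
  rewrite E1 E2 [(p 0 i)^-1 * _]mulrC; lra.
have primal : dotv g (xp - x') + a * dotv g (xs - x') = - (a * dotv g (y - xs)).
  have -> : xp = (1 + a) *: x' - a *: y by rewrite Ex' addrK.
  by rewrite !dotvBr !dotvZr; ring.
have := ler_wpM2l (ltW a1) fxp'.
have -> : (1 + a) * (f x' - a ^+ 2 / (1 + a) * sqnorm_mx Pinv g)
    = (1 + a) * f x' - a ^+ 2 * sqnorm_mx Pinv g by field; rewrite gt_eqF.
have := ler_wpM2l a0 tangent_xs.
lra.
Qed.

End SmoothConvex.

(** * The rate of rho *)

Section Rate.
Variables (R : realType) (alpha : nat -> R).

Lemma rhoS k : rho alpha k.+1 = rho alpha k / (1 + alpha k.+1).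
Proof. by rewrite /rho big_nat_recr. Qed.

Lemma rho_gt0 k : (forall j, (j <= k)%N -> 0 < alpha j) -> 0 < rho alpha k.
Proof.
move=> a0; rewrite /rho big_mkord; apply: prodr_gt0 => j _.
by rewrite invr_gt0 addr_gt0 // a0 // -ltnS.
Qed.

(** The telescoped step condition: since rho k * (1 + alpha k) is rho at the
    preceding index, the step sizes decay no faster than the square root of rho. *)
Lemma alpha_sqr_ge k :
  (forall j, (j <= k)%N -> 0 < alpha j) ->
  (forall j, (j < k)%N -> alpha j ^+ 2 <= alpha j.+1 ^+ 2 * (1 + alpha j)) ->
  alpha 0%N ^+ 2 * rho alpha k * (1 + alpha k) <= alpha k ^+ 2.
Proof.
elim: k => [|k IH] a0 growth.
  by rewrite /rho big_nat1 mulfVK // gt_eqF // addr_gt0 // a0.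
have ak1 : 0 < 1 + alpha k by rewrite addr_gt0 // a0.
have ak2 : 0 < 1 + alpha k.+1 by rewrite addr_gt0 // a0.
rewrite rhoS mulrA divfK ?gt_eqF // -(ler_pM2r ak1).
apply: le_trans (IH _ _) (growth _ _) => // j jk.
- by apply: a0; apply: leqW.
- by apply: growth; apply: leqW.
Qed.

(** Quadratic growth of 1 / rho. The constant c satisfies c <= 1, which starts the
    induction, and 3 * c <= alpha 0, which makes it go through:
    (m + 1)^2 <= m^2 + 3 * m for m >= 1, and the term 3 * c^2 * m * rho is at most
    the next alpha. *)
Lemma rho_sqr_le k (c := Num.min 1 (alpha 0%N) / 3) :
  (forall j, (j <= k)%N -> 0 < alpha j) ->
  (forall j, (j < k)%N -> alpha j ^+ 2 <= alpha j.+1 ^+ 2 * (1 + alpha j)) ->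
  c ^+ 2 * k.+1%:R ^+ 2 * rho alpha k <= 1.
Proof.
move=> a0 growth.
have c0 : 0 < c by rewrite divr_gt0 // lt_min ltr01 a0.
have c1 : c <= 1.
  have : Num.min 1 (alpha 0%N) <= 1 by rewrite ge_min lexx.
  rewrite /c; lra.
have ca : 3 * c <= alpha 0%N.
  have : Num.min 1 (alpha 0%N) <= alpha 0%N by rewrite ge_min lexx orbT.
  rewrite /c; lra.
clearbody c.
elim: k a0 growth => [|k IH] a0 growth.
  have a00 : 0 < alpha 0%N by exact: a0.
  rewrite /rho big_nat1 expr1n mulr1 ler_pdivrMr ?addr_gt0 // mul1r.
  nra.
have a0k j : (j <= k)%N -> 0 < alpha j by move=> jk; apply: a0; apply: leqW.
have growthk j : (j < k)%N -> alpha j ^+ 2 <= alpha j.+1 ^+ 2 * (1 + alpha j).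
  by move=> jk; apply: growth; apply: leqW.
have {}IH := IH a0k growthk.
have ak := a0 _ (leqnn k.+1).
have ak1 : 0 < 1 + alpha k.+1 by rewrite addr_gt0.
have := alpha_sqr_ge a0 growth.
have r0 := rho_gt0 a0k.
rewrite rhoS mulrA divfK ?gt_eqF // mulrA ler_pdivrMr // mul1r.
move: (rho alpha k) (alpha k.+1) ak r0 IH {ak1} => r a ak r0 IH H.
rewrite -(natr1 k.+1).
have m1 : 1 <= k.+1%:R :> R by rewrite ler1n.
move: (k.+1%:R : R) m1 IH => m m1 IH.
have : 3 * c ^+ 2 * m * r <= a.
  rewrite -(@ler_pXn2r _ 2) ?nnegrE //; last 2 first.
  - by rewrite !mulr_ge0 ?sqr_ge0 //; lra.
  - exact: ltW.
  apply: le_trans _ H.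
  have -> : (3 * c ^+ 2 * m * r) ^+ 2
      = (3 * c) ^+ 2 * r * (c ^+ 2 * m ^+ 2 * r) by ring.
  apply: le_trans (ler_wpM2l _ IH) _; first by rewrite mulr_ge0 ?sqr_ge0 // ltW.
  rewrite mulr1 ler_wpM2r ?(ltW r0) // lerXn2r ?nnegrE //; lra.
have : 0 <= (c ^+ 2 * r) * (m - 1) by rewrite !mulr_ge0 ?sqr_ge0 //; lra.
lra.
Qed.

End Rate.

(** * The convergence rate of the method *)

Unset Implicit Arguments.
Set Strict Implicit.

Theorem proposition3p1 (R : realType) (d : nat) (L : R) (f : 'cV[R]_d -> R)
    (xstar : 'cV[R]_d) (x y : nat -> 'cV[R]_d) (P : nat -> 'M[R]_d)
    (alpha beta gamma : nat -> R) (Rad : R)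
    (L_gt0 : 0 < L)
    (f_SL : smooth_convex L f)
    (xstar_argmin : forall z, f xstar <= f z)
    (P0_diag : is_diag_mx (P 0%N))
    (P0_posdef : posdefmx (P 0%N))
    (params_gt0 : forall k, generated f x k.+1 ->
       [/\ 0 < alpha k, 0 < beta k & 0 < gamma k])
    (x_step : forall k, generated f x k.+1 ->
       (alpha k)^-1 *: (x k.+1 - x k)
       = y k - x k.+1 - beta k *: (invmx (prevP P k) *m grad f (x k)))
    (y_step : forall k, generated f x k.+1 ->
       (alpha k)^-1 *: (y k.+1 - y k) = - (invmx (P k) *m grad f (x k.+1)))
    (P_step : forall k, generated f x k.+1 ->
       (alpha k)^-1 *: (P k.+1 - P k)
       = - P k.+1 + gamma k *: (invmx (P k) *m grad_sqmx f (x k.+1)))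
    (Rad_gt0 : 0 < Rad)
    (y_bounded : forall k, generated f x k -> `|y k - xstar| <= Rad)
    (eta_exact : forall k, generated f x k.+1 ->
       step_size alpha beta k = eta_bar L (invmx (prevP P k)) (grad f (x k)))
    (alpha_exact : forall k, generated f x k.+1 ->
       alpha k = Num.sqrt (step_size alpha beta k / 2))
    (gamma_exact : forall k, generated f x k.+1 ->
       gamma k = alpha k / Rad ^+ 2)
    (step_cond : forall k, generated f x k.+2 ->
       2 * alpha k ^+ 2 <= step_size alpha beta k.+1 * (1 + alpha k)) :
  (exists C : R, forall k, (1 <= k)%N -> generated f x k.+1 ->
     rho alpha k <= C / k%:R ^+ 2)
  /\ (exists C : R, forall k, (1 <= k)%N -> generated f x k.+1 ->
     energy f xstar alpha beta P x y k.+1 <= C / k%:R ^+ 2).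
Proof.
have [df cf lip] := f_SL.
have genW j k : (j <= k)%N -> generated f x k -> generated f x j.
  by move=> jk gk i ij; apply: gk; apply: leq_trans jk.
have a_gt0 k : generated f x k.+1 -> 0 < alpha k by move=> /params_gt0[].
have eta_alpha k : generated f x k.+1 -> step_size alpha beta k = 2 * alpha k ^+ 2.
  move=> gk; have [a0 b0 _] := params_gt0 k gk.
  rewrite alpha_exact // sqr_sqrtr ?divr_ge0 //; last by rewrite mulr_ge0 // ltW.
  by rewrite mulrC divfK // pnatr_eq0.
have P_diag k : generated f x k ->
    exists2 p : 'rV[R]_d, P k = diag_mx p & forall i, 0 < p 0 i.
  elim: k => [_|k IH gk1].
    have [p Pp] := diag_mxP _ P0_diag; exists p => // i.
    (* The form at the i-th basis vector is the i-th diagonal entry. *)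
    have [_ /(_ (delta_mx i 0))] := P0_posdef.
    rewrite Pp sqnorm_diag (bigD1 i) //= big1 => [|j ji].
      rewrite mxE !eqxx expr1n mulr1 addr0; apply.
      apply/eqP => /matrixP/(_ i 0); rewrite !mxE !eqxx => /eqP.
      by rewrite oner_eq0.
    by rewrite mxE (negPf ji) /= expr0n mulr0.
  have [p Pp p0] := IH (genW _ _ (leqnSn k) gk1).
  have [a0 _ c0] := params_gt0 k gk1.
  have a1 : 0 < 1 + alpha k by rewrite addr_gt0.
  exists ((1 + alpha k)^-1 *: (p + (alpha k * gamma k) *:
      \row_i ((p 0 i)^-1 * grad f (x k.+1) i 0 ^+ 2))).
    apply: (scalerI (lt0r_neq0 a1)).
    rewrite (implicit_step (lt0r_neq0 a0) (P_step k gk1)) Pp invmx_diag //.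
    rewrite [diag_mx (_ *: _)]linearZ /= scalerKV ?gt_eqF //.
    rewrite [diag_mx (_ + _)]linearD /= [diag_mx (_ *: _)]linearZ /=.
    rewrite /grad_sqmx mulmx_diag scalerA; congr (_ + _ *: diag_mx _).
    by apply/rowP => i; rewrite !mxE.
  move=> i; rewrite !mxE mulr_gt0 ?invr_gt0 // ltr_wpDr //.
  rewrite mulr_ge0 ?(mulr_ge0 (ltW a0) (ltW c0)) // mulr_ge0 ?sqr_ge0 //.
  by rewrite invr_ge0 ltW.
pose E := energy f xstar alpha beta P x y.
have energy_step k : generated f x k.+1 -> (1 + alpha k) * E k.+1 <= E k.
  move=> gk1; have gk := genW _ _ (leqnSn k) gk1.
  have [p Pp p0] := P_diag _ gk; have [q Pq q0] := P_diag _ gk1.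
  have a0 := a_gt0 _ gk1.
  have a1 : 0 < 1 + alpha k by rewrite addr_gt0.
  have Pinv := invmx_diag p0.
  rewrite /E /energy Pp Pq.
  apply: (@energy_contract _ _ f df p q _ (x k.+1) _ _ _ _ (alpha k) Rad) => //.
  - exact: ltW.
  - have xs : (alpha k)^-1 *: (x k.+1 - x k)
        = - x k.+1 + (y k - beta k *: (invmx (prevP P k) *m grad f (x k))).
      by rewrite x_step // addrA [- _ + _]addrC.
    rewrite (implicit_step (lt0r_neq0 a0) xs) /xplus scalerBr scalerA addrA.
    by rewrite addrAC.
  - have /(congr1 (GRing.scale (alpha k))) := y_step _ gk1.
    rewrite scalerA mulfV ?gt_eqF // scale1r Pp Pinv scalerN => /(canRL (subrK _)).
    by rewrite addrC.
  - move=> i; have := implicit_step (lt0r_neq0 a0) (P_step k gk1).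
    move=> /(congr1 (fun M : 'M[R]_d => M i i)).
    rewrite gamma_exact // Pp Pq Pinv /grad_sqmx mulmx_diag.
    rewrite !mxE eqxx !mulr1n => ->.
    by rewrite [(p 0 i)^-1 * _]mulrC -!mulrA.
  - exact: y_bounded gk1.
  - rewrite /xplus -Pinv -Pp -[P k]/(prevP P k.+1).
    (* At a terminal index k.+1 the step condition is not available, but both sides
       are equal. *)
    have [g0|g0] := eqVneq (grad f (x k.+1)) 0.
      rewrite g0 /sqnorm_mx !mulmx0 scaler0 subr0 /dotv big1 ?mulr0 ?subr0 // => i _.
      by rewrite mxE mul0r.
    have gk2 : generated f x k.+2.
      by move=> j; rewrite ltnS leq_eqVlt => /orP[/eqP->|/gk1].
    have Ak : (invmx (prevP P k.+1))^T = invmx (prevP P k.+1).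
      by rewrite /prevP /= Pp Pinv tr_diag_mx.
    rewrite eta_exact //; apply: le_trans (eta_bar_descent df _ L_gt0 lip Ak) _.
    rewrite lerD2l lerN2 -eta_exact //.
    apply: ler_wpM2r.
      rewrite /prevP /= Pp Pinv sqnorm_diag sumr_ge0 // => i _.
      by rewrite mxE mulr_ge0 ?sqr_ge0 // invr_ge0 ltW.
    rewrite ler_pdivrMr //; have := step_cond _ gk2; lra.
have energy_le k : generated f x k.+1 -> E k.+1 <= rho alpha k * E 0%N.
  elim: k => [|k IH] gk1.
    have a1 : 0 < 1 + alpha 0%N by rewrite addr_gt0 // a_gt0.
    by rewrite /rho big_nat1 mulrC ler_pdivlMr // mulrC energy_step.
  have a1 : 0 < 1 + alpha k.+1 by rewrite addr_gt0 // a_gt0.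
  rewrite rhoS mulrAC ler_pdivlMr // mulrC.
  apply: le_trans (energy_step _ gk1) (IH _); exact: genW gk1.
have E0 : 0 <= E 0%N.
  have g0 : generated f x 0 by move=> j.
  have [p Pp p0] := P_diag _ g0.
  rewrite /E /energy addr_ge0 ?subr_ge0 // mulr_ge0 ?invr_ge0 // Pp sqnorm_diag.
  by apply: sumr_ge0 => i _; rewrite mulr_ge0 ?sqr_ge0 // ltW.
pose c := Num.min 1 (alpha 0%N) / 3.
have rho_le k : (1 <= k)%N -> generated f x k.+1 ->
    rho alpha k <= c ^- 2 / k%:R ^+ 2.
  move=> k1 gk.
  have a0 j : (j <= k)%N -> 0 < alpha j.
    by move=> jk; apply: a_gt0; apply: genW gk; rewrite ltnS.
  have growth j : (j < k)%N -> alpha j ^+ 2 <= alpha j.+1 ^+ 2 * (1 + alpha j).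
    move=> jk; have gj : generated f x j.+2 by apply: genW gk.
    by have := step_cond _ gj; rewrite eta_alpha // -mulrA ler_pM2l.
  have c0 : 0 < c by rewrite divr_gt0 // lt_min ltr01 a0.
  have k0 : 0 < k%:R :> R by rewrite ltr0n.
  have ck0 : 0 < c ^+ 2 * k%:R ^+ 2.
    exact: mulr_gt0 (exprn_gt0 2 c0) (exprn_gt0 2 k0).
  rewrite -invfM -[leRHS]div1r (ler_pdivlMr _ _ ck0) mulrC.
  apply: le_trans _ (rho_sqr_le a0 growth).
  rewrite ler_wpM2r ?(ltW (rho_gt0 a0)) // ler_wpM2l ?sqr_ge0 //.
  by rewrite lerXn2r ?nnegrE ?ler0n // ler_nat.
split; first by exists (c ^- 2).
exists (c ^- 2 * E 0%N) => k k1 gk.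
apply: le_trans (energy_le _ gk) _; rewrite mulrAC.
by apply: ler_wpM2r => //; exact: rho_le.
Qed.
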